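(* Let $\sigma, c > 0$ and $\mu \ge 0$ be constants, and consider the wave equation with Kelvin-Voigt and viscous damping $$\frac{\partial}{\partial t}\left(\frac{\partial u}{\partial t}(t,z) - \sigma \frac{\partial^2 u}{\partial z^2}(t,z)\right) = c^2 \frac{\partial^2 u}{\partial z^2}(t,z) - \mu \frac{\partial u}{\partial t}(t,z) \quad \text{for } (t,z)\in(0,+\infty)\times(0,1),$$ $$u(t,0) - d(t) = u(t,1) = 0 \quad \text{for } t \ge 0.$$ Suppose that $$2c^2 < 2\mu\sigma + \sigma^2\pi^2.$$ Then there exist constants $M, \gamma, \delta > 0$ such that for every $u_0 \in C^2([0,1])$ and $w_0 \in C^0([0,1])$ with $u_0(1) = 0$ and $w_0 - \sigma u_0'' \in C^1([0,1])$, and for every $d \in C^0(\mathbb{R}_+)$ with $d(0) = u_0(0)$, for which there exists a unique pair of mappings $u \in C^1(\mathbb{R}_+\times[0,1])$, $w = \frac{\partial u}{\partial t} \in C^0(\mathbb{R}_+\times[0,1])$ with $w - \sigma u'' \in C^1(\mathbb{R}_+\times[0,1])$ and $u[t] \in C^2([0,1])$ for $t>0$, satisfying the wave equation $\frac{\partial}{\partial t}\left(\frac{\partial u}{\partial t} - \sigma \frac{\partial^2 u}{\partial z^2}\right) = c^2 \frac{\partial^2 u}{\partial z^2} - \mu \frac{\partial u}{\partial t}$ on $(0,+\infty)\times(0,1)$ and the boundary conditions $u(t,0) = d(t)$ and $u(t,1) = 0$ for $t \ge 0$, together with $u[0] = u_0$ and $\frac{\partial u}{\partial t}[0] = w_0$,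 the following inequality holds for all $t\ge 0$: $$\|u[t]\|_\infty + \left\|\frac{\partial u}{\partial t}[t] - \sigma u''[t]\right\|_\infty \le M\exp(-\delta t)\left(\|u_0\|_\infty + \|w_0 - \sigma u_0''\|_\infty\right) + \gamma \max_{0\le s\le t}|d(s)|.$$
   Context: $\mathbb{R}_+ := [0,+\infty)$. All functions are real-valued. For $u : \mathbb{R}_+ \times [0,1] \to \mathbb{R}$, $u[t]$ denotes the profile at time $t\ge 0$, i.e. $(u[t])(z) = u(t,z)$ for $z\in[0,1]$; $\frac{\partial u}{\partial t}[t]$ is the profile of $\frac{\partial u}{\partial t}$ at time $t$. A prime denotes differentiation with respect to the spatial variable $z$, so $u'' = \frac{\partial^2 u}{\partial z^2}$ for functions of $(t,z)$. $\|f\|_\infty$ is the (essential) supremum norm of $f$ on $[0,1]$. $C^k(U)$ denotes the functions on $U$ with continuous derivatives of order up to $k$ on $U$. *)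

(* Defs.v *)
From HB Require Import structures.
From mathcomp Require Import all_boot all_order all_algebra.
From mathcomp Require Import all_classical all_reals all_analysis.

Set Implicit Arguments.
Unset Strict Implicit.
Unset Printing Implicit Defensive.

Import Order.TTheory GRing.Theory Num.Theory.
Import numFieldNormedType.Exports.

Local Open Scope classical_set_scope.
Local Open Scope ring_scope.

(* Functions on a subset A of the line (or of the plane) are represented by
   total functions of which only the values on A are used: difference quotients
   are taken along points of A, so that derivatives at end points of A are
   one-sided. *)

Section relative_derivative.
Context {R : realType}.
Implicit Types (A : set R) (f : R -> R).

Definition diff_quotient f (x y : R) : R := (f y - f x) / (y - x).

Definition derivable_on A f (x : R) : Prop :=
  cvg (diff_quotient f x y @[y --> within A x^']).

(* meaningful only when [derivable_on A f x] and x is a limit point of A *)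
Definition derive_on A f (x : R) : R :=
  lim (diff_quotient f x y @[y --> within A x^']).

Fixpoint Ck (k : nat) A f : Prop :=
  {within A, continuous f} /\
  if k is k'.+1 then
    (forall x, A x -> derivable_on A f x) /\ Ck k' A (derive_on A f)
  else True.

End relative_derivative.

Section wave_equation.
Context {R : realType}.
Implicit Types (f u w : R -> R -> R) (sigma c mu : R) (d : R -> R).

Definition Rplus : set R := `[0, +oo[%classic.
Definition I01 : set R := `[0, 1]%classic.
Definition strip : set (R * R) := Rplus `*` I01.

Definition dt f (t z : R) : R := derive_on Rplus (f ^~ z) t.
Definition dz f (t z : R) : R := derive_on I01 (f t) z.
Definition dzz f : R -> R -> R := dz (dz f).

(* second derivative of a profile *)
Definition second (v : R -> R) : R -> R := derive_on I01 (derive_on I01 v).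

Definition C0_strip f : Prop :=
  {within strip, continuous (fun p : R * R => f p.1 p.2)}.

Definition C1_strip f : Prop :=
  [/\ C0_strip f,
      forall t z, strip (t, z) ->
        derivable_on Rplus (f ^~ z) t /\ derivable_on I01 (f t) z,
      C0_strip (dt f) & C0_strip (dz f)].

Definition admissible_data d (u0 w0 : R -> R) sigma : Prop :=
  [/\ Ck 2 I01 u0, Ck 0 I01 w0,
      Ck 1 I01 (fun z => w0 z - sigma * second u0 z),
      u0 1 = 0 & Ck 0 Rplus d /\ d 0 = u0 0].

Definition regular_pair sigma u w : Prop :=
  [/\ C1_strip u,
      C0_strip w,
      forall t z, strip (t, z) -> w t z = dt u t z,
      C1_strip (fun t z => w t z - sigma * dzz u t z) &
      forall t : R, 0 < t -> Ck 2 I01 (u t)].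

Definition wave_eq sigma c mu u : Prop :=
  forall t z : R, 0 < t -> 0 < z < 1 ->
    dt (fun s y => dt u s y - sigma * dzz u s y) t z =
    c ^+ 2 * dzz u t z - mu * dt u t z.

Definition solution sigma c mu d (u0 w0 : R -> R) u w : Prop :=
  [/\ regular_pair sigma u w,
      wave_eq sigma c mu u,
      forall t : R, 0 <= t -> u t 0 = d t /\ u t 1 = 0 &
      forall z, I01 z -> u 0 z = u0 z /\ dt u 0 z = w0 z].

(* uniqueness is that of the restrictions to R_+ x [0,1] *)
Definition unique_solution sigma c mu d (u0 w0 : R -> R) u w : Prop :=
  solution sigma c mu d u0 w0 u w /\
  forall u' w', solution sigma c mu d u0 w0 u' w' ->
    forall t z, strip (t, z) -> u' t z = u t z /\ w' t z = w t z.

(* essential supremum norm on [0,1]: f is extended by 0 outside [0,1] *)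
Definition norm_oo (f : R -> R) : \bar R :=
  ('N[@lebesgue_measure R]_+oo[EFin \o (f \_ I01)])%E.

(* for d continuous on R_+, the supremum is attained *)
Definition max_abs d (t : R) : R := sup [set `|d s| | s in `[0, t]].

End wave_equation.

(* Main.v *)
(** With [a = c^2 / sigma] and [k = a - mu], the variable
    [phi = u_t - sigma u'' - k u] turns the wave equation into a heat equation
    coupled with an ordinary differential equation at every point of the string:
      [u_t = sigma u'' + k u + phi],   [phi_t = - a phi - a k u].
    The small-gain condition says [2 k < sigma pi^2]; hence there are
    [theta < pi], [P > |k|] and [del > 0] such that
      [k - sigma theta^2 + P <= - del]   and   [a |k| - a P <= - del P].
    Put [eta z = cos (theta (z - 1/2))], which is positive on [0,1] and satisfies
    [eta'' = - theta^2 eta], and [E t = A exp (- del t) + B] with [A] measuring the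
    initial data and [B] the boundary data. Then [|u| <= eta E] and
    [|phi| <= P eta E]: if the maximum [m] of [|u| / (eta E)] over [0,T] x [0,1]
    were larger than 1, the differential equation would give
    [|phi| <= m P eta E], and the maximum principle for the heat equation would
    fail at the point where [m] is attained. *)

Require Import Defs.
From HB Require Import structures.
From mathcomp Require Import all_boot all_order all_algebra.
From mathcomp Require Import all_classical all_reals all_analysis.
From mathcomp Require Import ess_sup_inf ring lra.

Import Order.TTheory GRing.Theory Num.Theory.
Import numFieldNormedType.Exports.

Local Open Scope classical_set_scope.
Local Open Scope ring_scope.

(** * The essential supremum norm on the unit interval *)

Section sup_norm.
Context {R : realType}.
Implicit Types (f : R -> R) (C : R).

Lemma norm_ooE f :
  norm_oo f = ess_sup (@lebesgue_measure R) (abse \o (EFin \o (f \_ I01))).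
Proof.
(* The norm at infinity is an essential supremum only on a space of positive measure; this is
   checked on [[0, 1]], whose measure is 1. *)
rewrite /norm_oo unlock ifT //.
rewrite (@lt_le_trans _ _ (@lebesgue_measure R `[0, 1]%classic)) //.
  by rewrite lebesgue_measure_itv /= lte_fin ltr01 -EFinD lte_fin; lra.
by apply: le_measure; rewrite ?inE.
Qed.

(** The two end points form a null set, and outside [I01] the extension by 0 is bounded because [C]
    is nonnegative. Bounds are thus required only where the wave equation holds. *)
Lemma norm_oo_le f C : 0 <= C ->
  (forall z : R, 0 < z < 1 -> `|f z| <= C) -> (norm_oo f <= C%:E)%E.
Proof.
move=> C0 fC; rewrite norm_ooE; apply/ess_supP.
have N0 : (@lebesgue_measure R).-negligible ([set 0] `|` [set 1]).
  have N1 (y : R) : (@lebesgue_measure R).-negligible [set y].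
    by apply/negligibleP; [exact: measurable_set1 | exact: lebesgue_measure_set1].
  exact: negligibleU.
apply: negligibleS N0 => z /=; apply: contra_notP => /not_orP[z0 z1].
rewrite lee_fin patchE; case: ifPn => [|_]; last by rewrite normr0.
rewrite inE /I01 /= in_itv /= => /andP[z0' z1']; apply: fC.
by rewrite !lt_neqAle z0' z1' !andbT eq_sym; apply/andP; split; apply/eqP.
Qed.

(** Otherwise [N] would contain the open interval []a, b[] below, which is nonempty even when [z] is
    an end point, and so has positive measure. *)
Lemma ae_I01_exists (N : set R) (z e : R) :
  (@lebesgue_measure R).-negligible N -> I01 z -> 0 < e ->
  exists y, [/\ I01 y, `|z - y| < e & ~ N y].
Proof.
move=> nN; rewrite /I01 /= in_itv /= => /andP[z0 z1] e0; apply/not_existsP => H.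
set a := Num.max (z - e) 0; set b := Num.min (z + e) 1.
have ab : a < b by rewrite /a /b gt_max !lt_min; apply/andP; split; apply/andP; split; lra.
have sub : `]a, b[%classic `<=` N.
  move=> y /=; rewrite in_itv /= /a /b gt_max lt_min => /andP[/andP[y1 y2] /andP[y3 y4]].
  apply: contrapT => Ny; apply: (H y); split => //.
    by rewrite /= in_itv /=; lra.
  by rewrite ltr_norml; lra.
have : (@lebesgue_measure R).-negligible `]a, b[%classic by apply: negligibleS nN.
move=> /negligibleP => /(_ (measurable_itv _)) m0.
have : @lebesgue_measure R `]a, b[%classic = 0%E by exact: m0.
rewrite lebesgue_measure_itv /= lte_fin ab -EFinD => -[]; lra.
Qed.

(** If [|f z|] exceeded the essential supremum, continuity would keep [|f|] above it on a relative
    neighbourhood of [z], which cannot lie in a null set. *)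
Lemma norm_oo_ge f z :
  {within I01, continuous f} -> I01 z -> (`|f z|%:E <= norm_oo f)%E.
Proof.
move=> /subspace_continuousP cf Iz; rewrite leNgt norm_ooE; apply/negP => lt_f.
have := @ess_sup_ge _ _ _ (@lebesgue_measure R) (abse \o (EFin \o (f \_ I01))).
set s := ess_sup _ _ in lt_f *.
move=> aes.
(* Being nonnegative and below [|f z|], the essential supremum is finite, so the rest is real
   arithmetic. *)
have s0 : (0 <= s)%E.
  have [y [_ _ /contrapT]] := ae_I01_exists _ _ _ aes Iz ltr01.
  exact: le_trans (abse_ge0 _).
have sfin : s \is a fin_num by rewrite ge0_fin_numE// (lt_trans lt_f) ?ltry.
move: lt_f aes; rewrite -(fineK sfin) lte_fin; set r := fine s => rf aes.
have e0 : 0 < `|f z| - r by lra.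
have /cvgrPdist_lt/(_ _ e0) := cf z Iz.
rewrite near_withinE => /nbhs_ballP[e /= e_gt0 He].
have [y [Iy zy /contrapT]] := ae_I01_exists _ _ _ aes Iz e_gt0.
rewrite /= patchE mem_set // lee_fin => fyr.
have := He y zy Iy; have := ler_dist_dist (f z) (f y).
have := ler_norm (`|f z| - `|f y|); lra.
Qed.

Lemma continuous_norm_oo f : {within I01, continuous f} ->
  exists2 r : R, norm_oo f = r%:E & forall z, I01 z -> `|f z| <= r.
Proof.
move=> cf.
have I0 : I01 (0 : R) by rewrite /I01 /= in_itv /= lexx ler01.
have [c _ cmax] : exists2 c, c \in `[0, 1]%R & forall t, t \in `[0, 1]%R -> `|f t| <= `|f c|.
  apply: (@EVT_max R (fun x => `|f x|)); first exact: ler01.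
  move=> x; apply: continuous_comp; first exact: cf.
  exact: norm_continuous.
have fin : norm_oo f \is a fin_num.
  rewrite ge0_fin_numE; last exact: le_trans (norm_oo_ge _ _ cf I0).
  apply: (@le_lt_trans _ _ (`|f c|%:E)%E); last exact: ltry.
  by apply: norm_oo_le => // z /andP[z0 z1]; apply: cmax; rewrite in_itv /= !ltW.
exists (fine (norm_oo f)); first by rewrite fineK.
by move=> z Iz; rewrite -lee_fin fineK //; apply: norm_oo_ge.
Qed.

End sup_norm.

(** * Derivatives relative to a set, derivative tests at a maximum, and a linear differential
    inequality *)

Section relative_derivative.
Context {R : realType}.
Implicit Types (A : set R) (f g : R -> R) (x t : R).

Lemma derivable_on_is_derive A f x : nbhs x A -> derivable_on A f x ->
  is_derive x 1 f (derive_on A f x).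
Proof.
move=> nA df.
(* At an interior point of [A] the restriction of the punctured filter to [A] changes nothing. *)
have E : within A x^' = x^'.
  rewrite eqEsubset; split => B HB; last by rewrite /within; move: HB; apply: filterS.
  apply: filterS2 (nbhs_dnbhs nA) HB => y Ay; exact.
have {}df : diff_quotient f x y @[y --> x^'] --> derive_on A f x.
  by move: df; rewrite /derivable_on /derive_on E.
have H : (fun h => h^-1 *: ((f \o shift x) (h *: (1:R)) - f x)) @ 0^' --> derive_on A f x.
  apply/cvgrPdist_lt => e e0; move/cvgrPdist_lt: df => /(_ e e0).
  rewrite !near_withinE => /nbhs0P; apply: filterS => h Hh h0.
  have := Hh; rewrite /diff_quotient /= addrAC subrr add0r.
  rewrite mulrC -[in X in X -> _](subr_eq0 (x + h)) addrAC subrr add0r => -/(_ h0).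
  by rewrite [h *: _]mulr1 (addrC h).
by apply: DeriveDef; [apply/cvg_ex; exists (derive_on A f x) | apply: cvg_lim].
Qed.

Lemma eq_derive_on A f g x : A x -> {in A, f =1 g} ->
  derive_on A f x = derive_on A g x.
Proof.
move=> Ax fg; rewrite /derive_on; congr (lim _).
have E y : A y -> diff_quotient f x y = diff_quotient g x y.
  by move=> Ay; rewrite /diff_quotient !fg ?inE.
by rewrite eqEsubset; split; apply: near_eq_cvg; rewrite near_withinE;
  near=> y; move=> Ay; rewrite E.
Unshelve. all: by end_near. Qed.

Lemma is_derive_gt0 f x df : is_derive x 1 f df -> 0 < df ->
  exists2 e, 0 < e & forall y, y != x -> `|y - x| < e -> 0 < (f y - f x) * (y - x).
Proof.
move=> [fx <-] df0.
have : h^-1 *: ((f \o shift x) (h *: (1:R)) - f x) @[h --> 0^'] --> 'D_1 f x by [].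
move=> /cvgrPdist_lt/(_ _ df0); rewrite near_withinE => /nbhs_ballP[e /= e0 He].
exists e => // y yx yxe.
have yx0 : y - x != 0 by rewrite subr_eq0.
have /He/(_ yx0) : ball 0 e (y - x) by rewrite /ball /= sub0r normrN.
rewrite /= [(y - x) *: _]mulr1 subrK /GRing.scale /= => H.
have q0 : 0 < (y - x)^-1 * (f y - f x).
  by have := ler_norm ('D_1 f x - (y - x)^-1 * (f y - f x)); lra.
have -> : (f y - f x) * (y - x) = ((y - x)^-1 * (f y - f x)) * (y - x) ^+ 2.
  by field.
by rewrite mulr_gt0 // exprn_even_gt0.
Qed.

(** A negative derivative would make [f] larger just before [t]. Only earlier times are compared,
    since the maximum may be attained at the final time. *)
Lemma left_max_derive_ge0 f a t df : a < t -> is_derive t 1 f df ->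
  (forall s, a < s < t -> f s <= f t) -> 0 <= df.
Proof.
move=> lt_at dft ft; rewrite leNgt -oppr_gt0; apply/negP => df0.
have [e e0 He] := is_derive_gt0 (- f) t (- df) _ df0.
pose s := Num.max ((a + t) / 2) (t - e / 2).
have [s1 s2] : a < s /\ s < t.
  by rewrite /s lt_max gt_max; split; [apply/orP; left; lra | apply/andP; split; lra].
have s3 : t - e / 2 <= s by rewrite /s le_max lexx orbT.
have /He : s != t by rewrite lt_eqF.
rewrite ltr_norml => /(_ ltac:(lra)).
have := ft s; rewrite s1 s2 => /(_ isT) fst.
rewrite !fctE nmulr_lgt0; lra.
Qed.

(** The first derivative vanishes at [x]; if the second were positive, [f'] would be positive just
    to the right of [x], and the mean value theorem would give a value above [f x]. *)
Lemma local_max_derive2_le0 f f' a b x df' : a < x < b ->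
  (forall y, a < y < b -> is_derive y 1 f (f' y)) -> is_derive x 1 f' df' ->
  (forall y, a < y < b -> f y <= f x) -> df' <= 0.
Proof.
move=> /andP[ax xb] dff df'x fx; rewrite leNgt; apply/negP => df'0.
have f'x0 : f' x = 0.
  have fd t : t \in `]a, b[%R -> derivable f t 1.
    by rewrite in_itv /= => /dff[].
  have [|_ <-] := derive1_at_max (ltW (lt_trans ax xb)) fd _
    (fun t => fun tab : t \in `]a, b[%R => fx t tab); first by rewrite in_itv /= ax.
  by have [_ ->] := dff x (introT andP (conj ax xb)).
have [e e0 He] := is_derive_gt0 f' x df' df'x df'0.
pose y := Num.min ((x + b) / 2) (x + e / 2).
have [y1 y2] : x < y /\ y < b.
  by rewrite /y gt_min lt_min; split; [apply/andP; split; lra | apply/orP; left; lra].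
have y3 : y <= x + e / 2 by rewrite /y ge_min lexx orbT.
have [||c] := @MVT R f f' x y y1.
- by move=> z; rewrite in_itv /= => zxy; apply: dff; lra.
- apply: derivable_within_continuous => z; rewrite in_itv /= => zxy.
  by have [] := dff z; first lra.
rewrite in_itv /= => /andP[xc cy] fyx.
have /He : c != x by rewrite gt_eqF.
rewrite ltr_norml f'x0 subr0 => /(_ ltac:(lra)).
rewrite pmulr_lgt0 ?subr_gt0 // => f'c0.
have : 0 < f y - f x by rewrite fyx mulr_gt0 // subr_gt0.
by have := fx y; rewrite y2 (lt_trans ax y1) => /(_ isT); lra.
Qed.

(** With the integrating factor [expR (a * t)], the product [h] has nonpositive derivative on the
    open interval, so by the mean value theorem it stays below its initial value. *)
Lemma linear_ode_le0 (g dg : R -> R) (a T : R) :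
  (forall t, 0 < t < T -> is_derive t 1 g (dg t)) ->
  (forall t, 0 < t < T -> dg t <= - a * g t) ->
  {within `[0, T], continuous g} -> g 0 <= 0 ->
  forall t, 0 <= t <= T -> g t <= 0.
Proof.
move=> dgg dgle cg g0 t /andP[]; rewrite le_eqVlt => /predU1P[<- //|t0 tT].
have de (s : R) : is_derive s 1 (fun s : R => expR (a * s)) (a * expR (a * s)).
  apply: is_derive_eq; rewrite /GRing.scale /=; ring.
pose h := (fun s : R => expR (a * s)) * g.
have dh s : s \in `]0, t[%R -> is_derive s 1 h (expR (a * s) * (dg s + a * g s)).
  rewrite in_itv /= => st; have dgs := dgg s _.
  apply: is_derive_eq; first by apply: is_deriveM; apply: dgs; lra.
  rewrite /GRing.scale /=; ring.
have ch : {within `[0, t], continuous h}.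
  move=> x; apply: continuousM.
    apply: continuous_subspaceT => s; apply: differentiable_continuous.
    by apply/derivable1_diffP; have [] := de s.
  apply: continuous_subspaceW cg x => x /=; rewrite !in_itv /=; lra.
have [c] := MVT t0 dh ch.
rewrite in_itv /= subr0 => ct.
rewrite /h !fctE mulr0 expR0 mul1r => H.
have : expR (a * t) * g t <= 0.
  rewrite -[leLHS](subrK (g 0)) H.
  have : expR (a * c) * (dg c + a * g c) * t <= 0.
    apply: mulr_le0_ge0 (ltW t0); apply: mulr_ge0_le0 (expR_ge0 _) _.
    by have := dgle c; lra.
  lra.
by rewrite pmulr_rle0 // expR_gt0.
Qed.

End relative_derivative.

(** * Comparison principle for the coupled heat equation and pointwise differential equation *)

Section comparison.
Context {R : realType}.
Implicit Types (sigma s y a k theta P del A B m t z : R).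

(** This is [eta] of the overview. For [theta = pi] it would be the first Dirichlet eigenfunction
    [sin (pi z)], which vanishes at both ends; a smaller [theta] keeps it positive there. *)
Definition weight (theta z : R) : R := cos (theta * (z - 2^-1)).
Definition envelope (del A B t : R) : R := A * expR (- del * t) + B.

(** Cosine is even and decreasing on [[0, pi]], and [z] is at distance at most 1/2 from the
    midpoint. *)
Lemma weight_ge theta z : 0 < theta < pi -> 0 <= z <= 1 -> cos (theta / 2) <= weight theta z.
Proof.
move=> /andP[theta0 thetapi] z01; have pi0 := @pi_gt0 R.
have ab : `|z - 2^-1| <= 2^-1 by rewrite ler_norml; lra.
rewrite /weight -[X in _ <= X]cos_norm normrM (gtr0_norm theta0).
have ab' : theta * `|z - 2^-1| <= theta / 2 by rewrite ler_pM2l.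
have ab0 : 0 <= theta * `|z - 2^-1| by rewrite mulr_ge0 // ltW.
move: (theta * _) ab' ab0 => y y1 y0.
have t1 : 0 <= theta / 2 by lra.
have t2 : theta / 2 <= pi by lra.
have t3 : y <= pi by lra.
by rewrite leNgt ltr_cos -?leNgt ?in_itv //=; apply/andP.
Qed.

Lemma weight_min_gt0 theta : 0 < theta < pi -> 0 < cos (theta / 2).
Proof. by move=> /andP[theta0 thetapi]; apply: cos_gt0_pihalf; have := @pi_gt0 R; lra. Qed.

Lemma weight_gt0 theta z : 0 < theta < pi -> 0 <= z <= 1 -> 0 < weight theta z.
Proof.
by move=> th /(weight_ge _ _ th); apply: lt_le_trans (weight_min_gt0 _ th).
Qed.

Lemma weight_le1 theta z : weight theta z <= 1.
Proof. exact: cos_le1. Qed.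

Lemma is_derive_affine theta (x : R) : is_derive x 1 (fun z : R => theta * (z - 2^-1)) theta.
Proof. by apply: is_derive_eq; rewrite /GRing.scale /=; ring. Qed.

Lemma is_derive_weight theta z :
  is_derive z 1 (weight theta) (- theta * sin (theta * (z - 2^-1))).
Proof.
have d1 := is_derive_affine theta z.
by apply: is_derive_eq; rewrite /GRing.scale /=; ring.
Qed.

Lemma is_derive2_weight theta z :
  is_derive z 1 (fun z : R => - theta * sin (theta * (z - 2^-1))) (- theta ^+ 2 * weight theta z).
Proof.
have d1 := is_derive_affine theta z.
by apply: is_derive_eq; rewrite /GRing.scale /weight /=; ring.
Qed.

Lemma is_derive_envelope del A B t :
  is_derive t 1 (envelope del A B) (- del * (A * expR (- del * t))).
Proof. by apply: is_derive_eq; rewrite /GRing.scale /=; ring. Qed.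

Lemma envelope_gt0 del A B t : 0 <= A -> 0 < B -> 0 < envelope del A B t.
Proof. by move=> A0 B0; rewrite ltr_wpDl // mulr_ge0 // expR_ge0. Qed.

Lemma continuous_envelope del A B : continuous (envelope del A B).
Proof.
move=> t; apply: differentiable_continuous.
by apply/derivable1_diffP; have [] := is_derive_envelope del A B t.
Qed.

Lemma continuous_weight theta : continuous (weight theta).
Proof.
move=> t; apply: differentiable_continuous.
by apply/derivable1_diffP; have [] := is_derive_weight theta t.
Qed.

(* [m * weight theta z * envelope del A B t] is a strict supersolution of the parabolic
   equation with source [phi], so it cannot touch a solution from above. *)
Lemma no_contact sigma k theta P del A B (u : R -> R -> R) (uz : R -> R)
    (m ut uzz phi t z : R) :
  0 < sigma -> 0 < theta < pi -> 0 < del -> 0 <= A -> 0 < B ->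
  k - sigma * theta ^+ 2 + P <= - del ->
  0 < m -> 0 < t -> 0 < z < 1 ->
  is_derive t 1 (u ^~ z) ut ->
  (forall y : R, 0 < y < 1 -> is_derive y 1 (u t) (uz y)) ->
  is_derive z 1 uz uzz ->
  ut = sigma * uzz + k * u t z + phi ->
  phi <= m * (P * weight theta z * envelope del A B t) ->
  u t z = m * (weight theta z * envelope del A B t) ->
  (forall s : R, 0 < s < t -> u s z <= m * (weight theta z * envelope del A B s)) ->
  (forall y : R, 0 < y < 1 -> u t y <= m * (weight theta y * envelope del A B t)) -> False.
Proof.
move=> sigma0 th del0 A0 B0 gain_u m0 t0 z01 dut duz duzz eqn phile ueq utle uzle.
have w0 : 0 < weight theta z by apply: weight_gt0 => //; lra.
have e0 := envelope_gt0 del A B t A0 B0.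
have de := is_derive_envelope del A B t.
have ut_ge : m * weight theta z * (- del * (A * expR (- del * t))) <= ut.
  have d : is_derive t 1 (fun s => u s z - m * weight theta z * envelope del A B s)
      (ut - m * weight theta z * (- del * (A * expR (- del * t)))).
    by apply: is_derive_eq; rewrite /GRing.scale /=; ring.
  have := left_max_derive_ge0 _ 0 t _ t0 d _.
  rewrite subr_ge0; apply => s st.
  have := utle s st; rewrite ueq !mulrA; lra.
have uzz_le : uzz <= - m * theta ^+ 2 * (weight theta z * envelope del A B t).
  rewrite -subr_le0.
  apply: (@local_max_derive2_le0 _ (fun y => u t y - m * envelope del A B t * weight theta y)
    (fun y => uz y - m * envelope del A B t * (- theta * sin (theta * (y - 2^-1)))) 0 1 z) => //.
  - move=> y y01; have d1 := duz y y01; have d2 := is_derive_weight theta y.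
    by apply: is_derive_eq; rewrite /GRing.scale /=; ring.
  - have d2 := is_derive2_weight theta z.
    by apply: is_derive_eq; rewrite /GRing.scale /=; ring.
  - move=> y y01; have := uzle y y01; rewrite ueq mulrAC -mulrA [m * envelope del A B t * _]mulrAC -mulrA.
    lra.
(* The equation and [gain_u] bound [ut] above by [- del] times the whole barrier, while [ut_ge]
   bounds it below by [- del] times the exponential part only. The gap
   [del * (m * weight theta z * B)] is positive, a contradiction. *)
have wmB : 0 < m * weight theta z * B by rewrite !mulr_gt0.
have H1 : sigma * uzz <= sigma * (- m * theta ^+ 2 * (weight theta z * envelope del A B t)).
  by rewrite ler_pM2l.
have H2 : (k - sigma * theta ^+ 2 + P) * (m * weight theta z * envelope del A B t)
    <= - del * (m * weight theta z * envelope del A B t).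
  by rewrite ler_pM2r // !mulr_gt0.
have H3 : 0 < del * (m * weight theta z * B) by rewrite mulr_gt0.
move: ut_ge H1 H2 phile; rewrite eqn ueq /envelope.
set X := A * expR _ => ut_ge H1 H2 phile.
nra.
Qed.

(** For each sign [e], the difference [g] of [e * phi] and the barrier satisfies [g' <= - a * g]:
    the source [a * k * u] is absorbed through [gain_phi], with [del * P * (m * weight theta z * B)]
    to spare. *)
Lemma ode_bound a k theta P del A B (u phi : R -> R) (m T z : R) :
  0 < a -> 0 < theta < pi -> 0 < P -> 0 < del -> 0 <= A -> 0 < B ->
  a * `|k| - a * P <= - del * P ->
  0 < m -> 0 < z < 1 ->
  {within `[0, T], continuous phi} ->
  (forall t : R, 0 < t <= T -> is_derive t 1 phi (- a * phi t - a * k * u t)) ->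
  (forall t : R, 0 <= t <= T -> `|u t| <= m * (weight theta z * envelope del A B t)) ->
  `|phi 0| <= m * (P * weight theta z * envelope del A B 0) ->
  forall t : R, 0 <= t <= T -> `|phi t| <= m * (P * weight theta z * envelope del A B t).
Proof.
move=> a0 th P0 del0 A0 B0 gain_phi m0 z01 cphi dphi ule phi0 t tT.
have w0 : 0 < weight theta z by apply: weight_gt0 => //; lra.
have key (e : R) : (e = 1 \/ e = -1) -> e * phi t <= m * (P * weight theta z * envelope del A B t).
  move=> e1.
  have ne x : e * x <= `|x|.
    by case: e1 => ->; rewrite ?mul1r ?mulN1r ?ler_norm // -normrN ler_norm.
  have ke s : - (e * (k * s)) <= `|k| * `|s|.
    have := ne (- (k * s)); rewrite normrN normrM; lra.
  have := @linear_ode_le0 _ (fun s => e * phi s - m * (P * weight theta z) * envelope del A B s)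
    (fun s => e * (- a * phi s - a * k * u s)
       - m * (P * weight theta z) * (- del * (A * expR (- del * s)))) a T.
  move=> /(_ _ _ _ _ t tT) H; rewrite -subr_le0 mulrA; apply: H.
  - move=> s sT; have d1 := dphi s ltac:(lra); have d2 := is_derive_envelope del A B s.
    by apply: is_derive_eq; rewrite /GRing.scale /=; ring.
  - move=> s sT.
    have us := ule s ltac:(lra).
    have H1 : a * (- (e * (k * u s))) <= a * (`|k| * (m * (weight theta z * envelope del A B s))).
      rewrite ler_pM2l // (le_trans (ke _)) //; exact: ler_wpM2l.
    have H2 : (a * `|k| - a * P) * (m * weight theta z * envelope del A B s) <=
        - del * P * (m * weight theta z * envelope del A B s).
      by rewrite ler_pM2r // !mulr_gt0 // envelope_gt0.
    have H3 : 0 < del * P * (m * weight theta z * B) by rewrite !mulr_gt0.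
    move: H1 H2; rewrite /envelope; set X := A * expR _ => H1 H2; nra.
  - apply/subspace_continuousP => x xT; apply: cvgB; apply: cvgM.
    + exact: cvg_cst.
    + exact: (iffLR (subspace_continuousP _ _) cphi x xT).
    + exact: cvg_cst.
    + by apply: cvg_within_filter; exact: continuous_envelope.
  - rewrite /= subr_le0 -mulrA.
    exact: (le_trans (ne (phi 0)) phi0).
rewrite ler_norml lerNl; apply/andP; split.
  by have := key (-1) (or_intror erefl); rewrite mulN1r.
by have := key 1 (or_introl erefl); rewrite mul1r.
Qed.

(** The bounds on [u] and [phi] depend on each other. The circle is broken by the maximal ratio [m]:
    a bound on [u] with factor [m] passes to [phi] with the same factor, which is what [no_contact]
    excludes. *)
Lemma parabolic_ode_comparison sigma a k theta P del A B (T : R)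
    (u phi uz uzz : R -> R -> R) :
  0 < sigma -> 0 < a -> 0 < theta < pi -> 0 < P -> 0 < del -> 0 <= A -> 0 < B ->
  k - sigma * theta ^+ 2 + P <= - del ->
  a * `|k| - a * P <= - del * P ->
  {within `[0, T] `*` `[0, 1], continuous (fun p : R * R => u p.1 p.2)} ->
  (forall z : R, 0 < z < 1 -> {within `[0, T], continuous (phi ^~ z)}) ->
  (forall t z : R, 0 < t <= T -> 0 < z < 1 ->
    [/\ is_derive t 1 (u ^~ z) (sigma * uzz t z + k * u t z + phi t z),
        is_derive z 1 (u t) (uz t z), is_derive z 1 (uz t) (uzz t z) &
        is_derive t 1 (phi ^~ z) (- a * phi t z - a * k * u t z)]) ->
  (forall t z : R, 0 <= t <= T -> 0 <= z <= 1 -> [\/ t = 0, z = 0 | z = 1] ->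
    `|u t z| <= weight theta z * envelope del A B t) ->
  (forall z : R, 0 < z < 1 ->
    `|phi 0 z| <= P * weight theta z * envelope del A B 0) ->
  forall t z : R, 0 <= t <= T -> 0 <= z <= 1 ->
    `|u t z| <= weight theta z * envelope del A B t.
Proof.
move=> sigma0 a0 th P0 del0 A0 B0 gain_u gain_phi cu cphi eqs bd phi0 t1 z1 t1T z101.
rewrite leNgt; apply/negP => gt1.
pose b (p : R * R) := weight theta p.2 * envelope del A B p.1.
have b0 (p : R * R) : 0 <= p.2 <= 1 -> 0 < b p.
  by move=> p2; rewrite mulr_gt0 ?weight_gt0 ?envelope_gt0.
pose box : set (R * R) := `[0, T] `*` `[0, 1].
pose r (p : R * R) := `|u p.1 p.2| / b p.
have inbox (t z : R) : 0 <= t <= T -> 0 <= z <= 1 -> box (t, z).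
  by move=> tT z01; split; rewrite /= in_itv.
have cr : {within box, continuous r}.
  apply/subspace_continuousP => p pbox; apply: cvgM.
    by apply: cvg_norm; exact: (iffLR (subspace_continuousP _ _) cu p pbox).
  apply: cvgV; first by rewrite gt_eqF // b0 //; have [_] := pbox; rewrite /= in_itv.
  apply: cvg_within_filter; apply: cvgM.
    by apply: cvg_comp; [exact: cvg_snd | exact: continuous_weight].
  by apply: cvg_comp; [exact: cvg_fst | exact: continuous_envelope].
have [||[t z] /set_mem [/= + +] rmax] := @compact_EVT_max _ R r box _ _ cr.
- by exists (t1, z1); exact: inbox.
- by apply: compact_setX; exact: segment_compact.
rewrite !in_itv /= => tT z01.
set m := r (t, z) in rmax.
have m1 : 1 < m.
  have := rmax (t1, z1) (mem_set (inbox _ _ t1T z101)).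
  by apply: lt_le_trans; rewrite /r ltr_pdivlMr ?mul1r ?b0.
have um (s y : R) : 0 <= s <= T -> 0 <= y <= 1 ->
    `|u s y| <= m * (weight theta y * envelope del A B s).
  move=> sT y01; have := rmax (s, y) (mem_set (inbox _ _ sT y01)).
  by rewrite {1}/r ler_pdivrMr // b0.
have umax : `|u t z| = m * (weight theta z * envelope del A B t).
  by rewrite /m /r /b /= mulfVK // gt_eqF // (b0 (t, z)).
have m0 : 0 < m by lra.
(* On the parabolic boundary the ratio is at most 1, whereas [m] exceeds 1; the maximum is therefore
   interior in space and at a positive time. *)
have nbd : ~ [\/ t = 0, z = 0 | z = 1].
  move=> /(bd t z tT z01); rewrite umax leNgt => /negP; apply.
  by rewrite ltr_pMl // (b0 (t, z)).
have t0 : 0 < t.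
  rewrite lt_neqAle; move: tT => /andP[-> _]; rewrite andbT eq_sym.
  by apply/eqP => E; apply: nbd; apply: Or31.
have z0 : 0 < z < 1.
  rewrite !lt_neqAle; move: z01 => /andP[-> ->]; rewrite !andbT eq_sym.
  by apply/andP; split; apply/eqP => E; apply: nbd; [apply: Or32 | apply: Or33].
have tT' : 0 < t <= T by lra.
have phile : `|phi t z| <= m * (P * weight theta z * envelope del A B t).
  apply: (ode_bound a k theta P del A B (u ^~ z) (phi ^~ z) m T z) => //.
  - exact: cphi.
  - by move=> s sT; have [] := eqs s z sT z0.
  - by move=> s sT; apply: um.
  - apply: (le_trans (phi0 z z0)); rewrite ler_peMl ?ltW //.
    by rewrite !mulr_gt0 // ?weight_gt0 ?envelope_gt0 //.
(* The system is linear, so multiplying by the sign of [u t z] reduces to contact from below the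
   barrier. *)
have [e e1 eu] : exists2 e : R, e = 1 \/ e = -1 & e * u t z = `|u t z|.
  have [u0|u0] := leP 0 (u t z).
    by exists 1; [left | rewrite mul1r ger0_norm].
  by exists (-1); [right | rewrite mulN1r ltr0_norm].
have ne x : e * x <= `|x|.
  by case: e1 => ->; rewrite ?mul1r ?mulN1r ?ler_norm // -normrN ler_norm.
have dZ (f : R -> R) (x df : R) : is_derive x 1 f df ->
    is_derive x 1 (fun y => e * f y) (e * df).
  by move=> dfx; exact: is_deriveZ.
have [dut _ duzz _] := eqs t z tT' z0.
apply: (no_contact sigma k theta P del A B (fun s y => e * u s y)
  (fun y => e * uz t y) m
  (e * (sigma * uzz t z + k * u t z + phi t z)) (e * uzz t z) (e * phi t z) t z) => //.
- by move=> y y0; have [_ duz _ _] := eqs t y tT' y0; exact: dZ duz.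
- ring.
- exact: (le_trans (ne _) phile).
- by rewrite eu umax.
- by move=> s st; apply: (le_trans (ne _)); apply: um; lra.
- by move=> y yt; apply: (le_trans (ne _)); apply: um; lra.
Qed.

End comparison.

(** * Regularity and initial values of solutions of the wave equation *)

Lemma C0_strip_slice {R : realType} (f : R -> R -> R) (T z : R) :
  C0_strip f -> I01 z -> {within `[0, T], continuous (f ^~ z)}.
Proof.
move=> /subspace_continuousP cf Iz; apply/subspace_continuousP => t tT.
have tp (s : R) : `[0, T]%classic s -> strip (s, z).
  rewrite /= in_itv /= => sT; split => //=.
  by rewrite /Rplus /= in_itv /= andbT; lra.
have /cvgrPdist_lt H := cf (t, z) (tp t tT).
apply/cvgrPdist_lt => e e0; have := H e e0; rewrite !near_withinE.
move=> /nbhs_ballP[r /= r0 Hr]; apply/nbhs_ballP; exists r => //= s ts sT.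
by apply: (Hr (s, z)); [split => //=; exact: ballxx | exact: tp].
Qed.

Section solution.
Context {R : realType}.
Variables (sigma c mu : R) (d u0 w0 : R -> R) (u w : R -> R -> R).
Hypothesis sol : solution sigma c mu d u0 w0 u w.

(** The wave equation speaks of [v], the regularity assumption of [wv]. They agree only on [strip],
    so regularity has to be transferred from [wv] to [v]. *)
Let v (t z : R) : R := dt u t z - sigma * dzz u t z.
Let wv (t z : R) : R := w t z - sigma * dzz u t z.

Lemma nbhs_Rplus (t : R) : 0 < t -> nbhs t (@Rplus R).
Proof.
move=> t0; apply: filterS (lt_nbhsr t0) => s /= s0.
by rewrite /Rplus /= in_itv /= andbT ltW.
Qed.

Lemma nbhs_I01 (z : R) : 0 < z < 1 -> nbhs z (@I01 R).
Proof.
move=> /andP[z0 z1]; apply: filterS2 (lt_nbhsr z0) (lt_nbhsl z1) => y /= y0 y1.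
by rewrite /I01 /= in_itv /= !ltW.
Qed.

Let Rplus_le (t : R) : 0 <= t -> Rplus t.
Proof. by rewrite /Rplus /= in_itv /= andbT. Qed.

Let I01_le (z : R) : 0 <= z <= 1 -> I01 z.
Proof. by rewrite /I01 /= in_itv. Qed.

Lemma wvE (t z : R) : strip (t, z) -> wv t z = v t z.
Proof. by case: sol => -[_ _ wE _ _] _ _ _ tz; rewrite /wv wE. Qed.

Lemma solution_interior (t z : R) : 0 < t -> 0 < z < 1 ->
  [/\ is_derive t 1 (u ^~ z) (dt u t z), is_derive z 1 (u t) (dz u t z),
      is_derive z 1 (dz u t) (dzz u t z) &
      is_derive t 1 (v ^~ z) (c ^+ 2 * dzz u t z - mu * dt u t z)].
Proof.
move=> t0 z01.
have tz : strip (t, z) by split => /=; [apply: Rplus_le; lra | apply: I01_le; lra].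
have [tn zn] := (nbhs_Rplus t t0, nbhs_I01 z z01).
case: sol => -[[_ du _ _] _ wE [_ dwv _ _] Cku] weq _ _.
have [_ [_ [_ [dzu _]]]] := Cku t t0.
have [dtu dzu'] := du t z tz.
split; try exact: derivable_on_is_derive.
  by apply: derivable_on_is_derive => //; apply: dzu; case: tz.
(* Derivatives along [Rplus] see only points of [strip], where [v] and [wv] coincide. *)
have E : dt v t z = dt wv t z.
  apply: eq_derive_on; first by case: tz.
  by move=> s /set_mem s0; apply/esym/wvE; split => //; case: tz.
rewrite -weq // -/v E.
have [dtwv _] := dwv t z tz.
apply: near_eq_is_derive (derivable_on_is_derive _ _ _ tn dtwv).
near=> s; apply: (wvE s z); split => /=; last by case: tz.
by near: s.
Unshelve. all: by end_near. Qed.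

Lemma solution_init (z : R) : I01 z ->
  u 0 z = u0 z /\ v 0 z = w0 z - sigma * second u0 z.
Proof.
move=> Iz; case: sol => _ _ _ init; have [u0z wz] := init z Iz.
split=> //; rewrite /v wz; congr (_ - _ * _).
(* Derivatives along [I01] depend only on values there, so the initial condition may be
   differentiated twice. *)
apply: eq_derive_on => // y /set_mem Iy; apply: eq_derive_on => // x /set_mem Ix.
by have [] := init x Ix.
Qed.

Lemma solution_continuous_slice (T z : R) : I01 z -> {within `[0, T], continuous (v ^~ z)}.
Proof.
move=> Iz; case: sol => -[_ _ _ [cwv _ _ _] _] _ _ _.
have cs := C0_strip_slice _ T z cwv Iz.
apply: subspace_eq_continuous cs => t /set_mem; rewrite /= in_itv /= => tT.
by apply: wvE; split => //=; apply: Rplus_le; lra.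
Qed.

End solution.

(** * Boundary data, choice of the constants, and the final estimate *)

Lemma norm_le_max_abs {R : realType} (d : R -> R) (t s : R) :
  {within Rplus, continuous d} -> 0 <= s <= t -> `|d s| <= max_abs d t.
Proof.
move=> cd st; apply: ub_le_sup; last by exists s => //=; rewrite in_itv.
have t0 : 0 <= t by lra.
(* [sup] is an upper bound only for a set bounded above; the bound comes from the extreme value
   theorem. *)
have [x _ xmax] : exists2 x, x \in `[0, t]%R & forall y, y \in `[0, t]%R -> `|d y| <= `|d x|.
  apply: (@EVT_max R (fun y => `|d y|)) => // x; apply: continuous_comp.
    apply: continuous_subspaceW cd x => y /=; rewrite /Rplus /= !in_itv /=; lra.
  exact: norm_continuous.
by exists `|d x| => _ /= [y yt <-]; exact: xmax.
Qed.

Lemma gain_parameters (R : realType) (sigma a k : R) :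
  0 < sigma -> 0 < a -> 2 * k < sigma * pi ^+ 2 ->
  exists theta P del : R, [/\ 0 < theta < pi, 0 < P, 0 < del,
    k - sigma * theta ^+ 2 + P <= - del & a * `|k| - a * P <= - del * P].
Proof.
move=> sigma0 a0 kpi; have pi0 := pi_gt0 R.
have kk : `|k| + k < sigma * pi ^+ 2.
  have : 0 < sigma * pi ^+ 2 by rewrite mulr_gt0 ?exprn_gt0.
  by case: (lerP 0 k) => k0; [rewrite ger0_norm | rewrite ltr0_norm]; lra.
have kk0 : 0 <= `|k| + k by have := ler_norm (- k); rewrite normrN; lra.
(* [q] is the square of [theta], the midpoint between [(|k| + k) / sigma] and [pi ^+ 2]. *)
pose q := ((`|k| + k) / sigma + pi ^+ 2) / 2.
have kq : sigma * q = ((`|k| + k) + sigma * pi ^+ 2) / 2.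
  by rewrite /q; field; rewrite gt_eqF.
have q0 : 0 < q.
  by rewrite divr_gt0 // ltr_wpDl ?exprn_gt0 // divr_ge0 // ltW.
have qpi : q < pi ^+ 2 by rewrite -(ltr_pM2l sigma0) kq; lra.
(* Half of the margin [2 * g] goes into [P = |k| + g], the other half is left for decay. Then
   [del = a * g / (P + a)] satisfies both [del <= g] and [del * P <= a * g]. *)
pose g := (sigma * q - k - `|k|) / 2.
have g0 : 0 < g by rewrite /g kq; lra.
have P0 : 0 < `|k| + g by rewrite ltr_wpDl.
have Pa0 : 0 < `|k| + g + a by exact: addr_gt0.
have del0 : 0 < a * g / (`|k| + g + a) by rewrite divr_gt0 // mulr_gt0.
exists (Num.sqrt q), (`|k| + g), (a * g / (`|k| + g + a)); split => //.
- rewrite sqrtr_gt0 q0 /= -[ltRHS](gtr0_norm pi0) -sqrtr_sqr ltr_sqrt //.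
  by rewrite exprn_gt0.
- rewrite sqr_sqrtr; last exact: ltW.
  have dg : a * g / (`|k| + g + a) <= g.
    by rewrite ler_pdivrMr // mulrC ler_pM2l //; lra.
  have -> : k - sigma * q + (`|k| + g) = - g by rewrite /g; field.
  by rewrite lerN2.
- have : a * g / (`|k| + g + a) * (`|k| + g) <= a * g.
    by rewrite mulrAC ler_pdivrMr // ler_pM2l ?mulr_gt0 //; lra.
  lra.
Qed.

(** The horizon [T] is fixed first, because the constant part of the envelope contains the maximum
    of [|d|] up to [T]. The term [e] keeps that part positive when [d] vanishes. *)
Lemma solution_estimate (R : realType) (sigma c mu theta P del r0 r1 e T : R)
    (d u0 w0 : R -> R) (u w : R -> R -> R) :
  let k := c ^+ 2 / sigma - mu in
  let K := (cos (theta / 2))^-1 * (1 + (1 + `|k|) / P) in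
  let b := K * (r0 + r1) * expR (- del * T)
    + ((cos (theta / 2))^-1 * max_abs d T + e) in
  0 < sigma -> 0 < c -> 0 < theta < pi -> 0 < P -> 0 < del -> 0 < e ->
  k - sigma * theta ^+ 2 + P <= - del ->
  c ^+ 2 / sigma * `|k| - c ^+ 2 / sigma * P <= - del * P ->
  {within Rplus, continuous d} -> solution sigma c mu d u0 w0 u w ->
  (forall z, I01 z -> `|u0 z| <= r0) ->
  (forall z, I01 z -> `|w0 z - sigma * second u0 z| <= r1) ->
  0 <= T -> forall z : R, 0 < z < 1 ->
  `|u T z| <= b /\ `|dt u T z - sigma * dzz u T z| <= (P + `|k|) * b.
Proof.
move=> k K b sigma0 c0 th P0 del0 e0 gain_u gain_phi cd sol u0r v0r T0.
set cm := cos (theta / 2) in K b *; set D := max_abs d T in b *.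
have cm0 : 0 < cm := weight_min_gt0 _ th.
pose a := c ^+ 2 / sigma.
have a0 : 0 < a by rewrite divr_gt0 ?exprn_gt0.
have I010 : I01 (0 : R) by rewrite /I01 /= in_itv /= lexx ler01.
have r00 : 0 <= r0 := le_trans (normr_ge0 _) (u0r 0 I010).
have r10 : 0 <= r1 := le_trans (normr_ge0 _) (v0r 0 I010).
have D0 : 0 <= D.
  by apply: (le_trans (normr_ge0 (d 0))); apply: norm_le_max_abs => //; lra.
pose A := K * (r0 + r1); pose B := cm^-1 * D + e.
(* [K] is chosen so that [cm * A] dominates [|u0|] and [P * cm * A] dominates [r1 + |k| * r0], the
   initial bound on [phi]; [cm] is the minimum of the weight. *)
have K1 : cm * K = 1 + (1 + `|k|) / P by rewrite /K mulrA divff ?mul1r // gt_eqF.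
have k0 : 0 <= (1 + `|k|) / P by rewrite divr_ge0 ?addr_ge0 // ltW.
have K0 : 0 <= K by rewrite -(pmulr_rge0 _ cm0) K1 addr_ge0.
have A0 : 0 <= A by rewrite mulr_ge0 ?addr_ge0.
have B0 : 0 < B by rewrite ltr_wpDl // mulr_ge0 // invr_ge0 ltW.
have cA : cm * A = (r0 + r1) + (1 + `|k|) / P * (r0 + r1).
  by rewrite /A mulrA K1 mulrDl mul1r.
have cB : D <= cm * B.
  by rewrite /B mulrDr mulrA divff ?gt_eqF // mul1r lerDl mulr_ge0 // ltW.
have envB (t : R) : B <= envelope del A B t.
  by rewrite lerDr mulr_ge0 ?expR_ge0.
have env0 : envelope del A B 0 = A + B by rewrite /envelope mulr0 expR0 mulr1.
have I01P (z : R) : 0 <= z <= 1 -> I01 z by rewrite /I01 /= in_itv.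
have wge (z x : R) : 0 <= z <= 1 -> 0 <= x -> cm * x <= weight theta z * x.
  by move=> z01 x0; rewrite ler_wpM2r // weight_ge.
pose v (t z : R) := dt u t z - sigma * dzz u t z.
pose phi (t z : R) := v t z - k * u t z.
have cu : {within `[0, T] `*` `[0, 1], continuous (fun p : R * R => u p.1 p.2)}.
  case: sol => -[[cu _ _ _] _ _ _ _] _ _ _.
  apply: continuous_subspaceW cu => -[t z] [/=]; rewrite !in_itv /= => t0 z01.
  by split; [rewrite /Rplus /= in_itv /= andbT; lra | exact: I01P].
have cphi (z : R) : 0 < z < 1 -> {within `[0, T], continuous (phi ^~ z)}.
  move=> z01; have Iz : I01 z by apply: I01P; lra.
  apply/subspace_continuousP => t tT; apply: cvgB.
    exact: (iffLR (subspace_continuousP _ _) (solution_continuous_slice _ _ _ _ _ _ _ _ sol T z Iz)).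
  apply: cvgM; first exact: cvg_cst.
  have [[[cu' _ _ _] _ _ _ _] _ _ _] := sol.
  exact: (iffLR (subspace_continuousP _ _) (C0_strip_slice _ T z cu' Iz)).
have eqs (t z : R) : 0 < t <= T -> 0 < z < 1 ->
    [/\ is_derive t 1 (u ^~ z) (sigma * dzz u t z + k * u t z + phi t z),
        is_derive z 1 (u t) (dz u t z), is_derive z 1 (dz u t) (dzz u t z) &
        is_derive t 1 (phi ^~ z) (- a * phi t z - a * k * u t z)].
  move=> /andP[t0 _] z01.
  have [dtu dzu dzzu dtv] := solution_interior _ _ _ _ _ _ _ _ sol t z t0 z01.
  split => //; first by rewrite (_ : _ + _ = dt u t z) // /phi /v; ring.
  apply: is_derive_eq; rewrite /GRing.scale /= /phi /v /k /a.
  by field; rewrite gt_eqF.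
have bd (t z : R) : 0 <= t <= T -> 0 <= z <= 1 -> [\/ t = 0, z = 0 | z = 1] ->
    `|u t z| <= weight theta z * envelope del A B t.
  move=> tT z01 tz.
  have env_ge0 := ltW (envelope_gt0 del A B t A0 B0).
  apply: (le_trans _ (wge z _ z01 env_ge0)).
  have [_ _ bc _] := sol; have [ud u1] := bc t ltac:(lra).
  case: tz => E.
  - rewrite E env0 mulrDr cA; have [-> _] := solution_init _ _ _ _ _ _ _ _ sol z (I01P z z01).
    have := u0r z (I01P z z01).
    have : 0 <= (1 + `|k|) / P * (r0 + r1) by rewrite mulr_ge0 ?addr_ge0.
    by have := mulr_gt0 cm0 B0; lra.
  - rewrite E ud; apply: (le_trans (norm_le_max_abs _ _ _ cd tT)).
    by apply: (le_trans cB); rewrite ler_pM2l.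
  - by rewrite E u1 normr0 mulr_ge0 // ltW.
have phi0 (z : R) : 0 < z < 1 ->
    `|phi 0 z| <= P * weight theta z * envelope del A B 0.
  move=> z01; have Iz : I01 z by apply: I01P; lra.
  have [uE vE] := solution_init _ _ _ _ _ _ _ _ sol z Iz.
  have AB0 : 0 <= A + B by rewrite addr_ge0 // ltW.
  rewrite env0 -mulrA; apply: (@le_trans _ _ (P * (cm * (A + B)))); last first.
    by rewrite ler_pM2l // wge //; lra.
  rewrite mulrDr cA /phi /v uE vE.
  have H1 : `|w0 z - sigma * second u0 z - k * u0 z| <= r1 + `|k| * r0.
    apply: (le_trans (ler_normB _ _)); rewrite normrM lerD ?v0r //.
    by rewrite ler_wpM2l ?u0r.
  apply: (le_trans H1).
  have -> : P * (r0 + r1 + (1 + `|k|) / P * (r0 + r1) + cm * B) =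
     P * (r0 + r1) + (r0 + r1) + `|k| * r0 + `|k| * r1 + P * (cm * B).
    by field; rewrite gt_eqF.
  have := mulr_ge0 (normr_ge0 k) r10; have := mulr_gt0 P0 (mulr_gt0 cm0 B0).
  by have := mulr_ge0 (ltW P0) (addr_ge0 r00 r10); lra.
have um := parabolic_ode_comparison sigma a k theta P del A B T u phi (dz u) (dzz u)
  sigma0 a0 th P0 del0 A0 B0 gain_u gain_phi cu cphi eqs bd phi0.
move=> z z01; have z01' : 0 <= z <= 1 by lra.
have TT : 0 <= T <= T by lra.
have b0 : 0 <= b := ltW (envelope_gt0 del A B T A0 B0).
have uT : `|u T z| <= b.
  by apply: (le_trans (um T z TT z01')); rewrite ler_piMl // weight_le1.
split=> //.
(* With [u] now controlled with factor 1, the differential equation controls [phi], and the second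
   bound follows from [v = phi + k * u]. *)
have phiT : `|phi T z| <= 1 * (P * weight theta z * envelope del A B T).
  apply: (ode_bound a k theta P del A B (u ^~ z) (phi ^~ z) 1 T z) => //.
  - exact: cphi.
  - by move=> t tT; have [] := eqs t z tT z01.
  - by move=> t tT; rewrite mul1r; exact: um.
  - by rewrite mul1r; exact: phi0.
have -> : dt u T z - sigma * dzz u T z = phi T z + k * u T z by rewrite /phi subrK.
rewrite [leRHS]mulrDl; apply: (le_trans (ler_normD _ _)); apply: lerD.
  apply: (le_trans phiT); rewrite mul1r -mulrA ler_pM2l //.
  by rewrite ler_piMl // weight_le1.
by rewrite normrM ler_wpM2l.
Qed.

Theorem corollary2p3 (R : realType) (sigma c mu : R)
    (sigma_gt0 : 0 < sigma) (c_gt0 : 0 < c) (mu_ge0 : 0 <= mu)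
    (small_gain : 2 * c ^+ 2 < 2 * mu * sigma + sigma ^+ 2 * pi ^+ 2) :
  exists M gamma delta : R,
    [/\ 0 < M, 0 < gamma, 0 < delta &
      forall u0 w0 d : R -> R, admissible_data d u0 w0 sigma ->
      forall u w : R -> R -> R, unique_solution sigma c mu d u0 w0 u w ->
      forall t : R, 0 <= t ->
        (norm_oo (u t) + norm_oo (fun z => (dt u t z - sigma * dzz u t z)%R)
         <= (M * expR (- delta * t))%:E *
              (norm_oo u0 + norm_oo (fun z => (w0 z - sigma * second u0 z)%R))
            + (gamma * max_abs d t)%:E)%E].
Proof.
have a0 : 0 < c ^+ 2 / sigma by rewrite divr_gt0 ?exprn_gt0.
set k := c ^+ 2 / sigma - mu.
have kpi : 2 * k < sigma * pi ^+ 2.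
  rewrite -(ltr_pM2l sigma_gt0).
  have -> : sigma * (2 * k) = 2 * c ^+ 2 - 2 * mu * sigma.
    by rewrite /k; field; rewrite gt_eqF.
  by rewrite [ltRHS]mulrA -expr2; lra.
have [theta [P [del [th P0 del0 gain_u gain_phi]]]] :=
  gain_parameters R sigma (c ^+ 2 / sigma) k sigma_gt0 a0 kpi.
have cm0 := weight_min_gt0 _ th.
set cm := cos (theta / 2) in cm0.
(* [L] adds the factor 1 of the bound on [u] and the factor [P + |k|] of the bound on
   [dt u - sigma * dzz u]. *)
pose L := 1 + P + `|k|; pose K := cm^-1 * (1 + (1 + `|k|) / P).
have L0 : 0 < L by rewrite /L -addrA ltr_wpDr // addr_ge0 // ltW.
have K0 : 0 < K.
  by rewrite mulr_gt0 ?invr_gt0 // ltr_wpDr // divr_ge0 ?addr_ge0 // ltW.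
exists (L * K), (L * cm^-1), del; split => //.
- exact: mulr_gt0.
- by rewrite mulr_gt0 ?invr_gt0.
move=> u0 w0 d [[cu0 _] _ [cv0 _] _ [[cd _] _]] u w [sol _] t t0.
have [r0 -> u0r] := continuous_norm_oo _ cu0.
have [r1 -> v0r] := continuous_norm_oo _ cv0.
(* It suffices to prove the inequality up to every [e > 0]. The estimate is used with [e / L], which
   the factor [L] turns back into [e]. *)
apply/lee_addgt0Pr => e e0; set D := max_abs d t.
pose b := K * (r0 + r1) * expR (- del * t) + (cm^-1 * D + e / L).
have est (z : R) : 0 < z < 1 ->
    `|u t z| <= b /\ `|dt u t z - sigma * dzz u t z| <= (P + `|k|) * b.
  by apply: (solution_estimate R sigma c mu theta P del r0 r1 (e / L) t
    d u0 w0 u w) => //; rewrite divr_gt0.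
have b0 : 0 <= b.
  by have [+ _] := est 2^-1 ltac:(lra); apply: le_trans.
have h1 : (norm_oo (u t) <= b%:E)%E.
  by apply: norm_oo_le => // z /est[].
have h2 : (norm_oo (fun z => (dt u t z - sigma * dzz u t z)%R)
    <= ((P + `|k|) * b)%:E)%E.
  by apply: norm_oo_le => [|z /est[] //]; rewrite mulr_ge0 // addr_ge0 // ltW.
apply: (le_trans (leeD h1 h2)).
rewrite -!(EFinD, EFinM) lee_fin.
have -> : b + (P + `|k|) * b = L * b by rewrite /L; ring.
have -> : L * b = L * K * expR (- del * t) * (r0 + r1) + L * cm^-1 * D + e.
  have eL : L * (e / L) = e by rewrite mulrC divfK // gt_eqF.
  by rewrite -[in RHS]eL /b; ring.
exact: lexx.
Qed.
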